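(* Any $\vec k\in\mathcal G_{VV}^o$ (regarded as a function on the network that is constant, equal to $k_h$, on each road $\Omega_h$) can be obtained as the limit in the $L^1_{loc}$ sense, as $\varepsilon\to0$, of a family $\vec k^\varepsilon$, $\varepsilon>0$, of stationary solutions of the following viscous junction problem: $$\rho^\varepsilon_{h,t}+f_h(\rho^\varepsilon_h)_x=\varepsilon\rho^\varepsilon_{h,xx},\quad t>0,\ x\in\Omega_h,\ h\in\{1,\dots,m+n\},$$ $$\rho^\varepsilon_h(t,0)=\rho^\varepsilon_{h'}(t,0),\quad t>0,\ h,h'\in\{1,\dots,m+n\},$$ $$\sum_{i=1}^m\big(f_i(\rho^\varepsilon_i(t,0))-\varepsilon\rho^\varepsilon_{i,x}(t,0)\big)=\sum_{j=m+1}^{m+n}\big(f_j(\rho^\varepsilon_j(t,0))-\varepsilon\rho^\varepsilon_{j,x}(t,0)\big),\quad t>0.$$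
   Context: $m,n\ge1$ are integers, $R>0$. Incoming roads $\Omega_i=(-\infty,0)$, $i\in\{1,\dots,m\}$; outgoing roads $\Omega_j=(0,+\infty)$, $j\in\{m+1,\dots,m+n\}$; $h$ is any road index. For each $h$, the flux $f_h:[0,R]\to[0,+\infty)$ satisfies: (F) $f_h$ is Lipschitz with $\|f_h'\|_\infty\le L_h$, $f_h(0)=f_h(R)=0$, and there exists $\bar\rho_h\in(0,R)$ such that $f_h'(\rho)(\bar\rho_h-\rho)>0$ for a.e. $\rho\in[0,R]$; (NLD) $f_h'$ is not constant on any non-trivial subinterval of $[0,R]$. Godunov flux: $G_h(a,b)=\min_{s\in[a,b]}f_h(s)$ if $a\le b$ and $G_h(a,b)=\max_{s\in[b,a]}f_h(s)$ if $a\ge b$, for $a,b\in[0,R]$. Notation: $I[a,b]=[\min\{a,b\},\max\{a,b\}]$. $\mathcal G_{VV}$ is the set of $\vec u\in[0,R]^{m+n}$ for which there exists $p\in[0,R]$ such that $\sum_{i=1}^mG_i(u_i,p)=\sum_{j=m+1}^{m+n}G_j(p,u_j)$, $G_i(u_i,p)=f_i(u_i)$ for all $i$, and $G_j(p,u_j)=f_j(u_j)$ for all $j$. $\mathcal G_{VV}^o$ is the set of $\vec k\in\mathcal G_{VV}$ for which there exists $p\in[0,R]$ such that $\sum_{i=1}^mG_i(k_i,p)=\sum_{j=m+1}^{m+n}G_j(p,k_j)$; for all $i$ and all $s\in I[k_i,p]\setminus\{k_i\}$, $(p-k_i)(f_i(s)-f_i(k_i))>0$; for all $j$ and all $s\in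 I[p,k_j]\setminus\{k_j\}$, $(k_j-p)(f_j(s)-f_j(k_j))>0$. A stationary solution is a $[0,R]^{m+n}$-valued solution $(\rho^\varepsilon_1,\dots,\rho^\varepsilon_{m+n})$ whose components do not depend on $t$. $L^1_{loc}$ convergence means convergence of each component in $L^1$ on bounded subsets of $\Omega_h$. *)

(* Defs.v *)
From HB Require Import structures.
From mathcomp Require Export all_boot all_order all_algebra.
From mathcomp Require Export all_classical all_reals all_analysis.
Export Order.TTheory GRing.Theory Num.Theory.
Export numFieldNormedType.Exports.

Set Implicit Arguments.
Unset Strict Implicit.
Unset Printing Implicit Defensive.

Local Open Scope ring_scope.
Local Open Scope classical_set_scope.

(* Throughout, the roads are indexed by 'I_(m + n): the incoming ones are
   lshift n i with i : 'I_m, the outgoing ones rshift m j with j : 'I_n.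
   A flux on [0, rmax] is a function R -> R whose values outside [0, rmax] are
   irrelevant. *)

(* derive1 f is total, hence differentiability is part of the a.e. conditions. *)
Definition flux_F {R : realType} (rmax L : R) (f : R -> R) : Prop :=
  [/\ forall x : R, 0 <= x <= rmax -> 0 <= f x,
      [lipschitz f x | x in `[0, rmax]%classic],
      {ae lebesgue_measure, forall x : R, 0 <= x <= rmax ->
        derivable f x 1 /\ `|derive1 f x| <= L},
      f 0 = 0 /\ f rmax = 0 &
      exists2 rbar : R, 0 < rbar < rmax &
        {ae lebesgue_measure, forall x : R, 0 <= x <= rmax ->
          derivable f x 1 /\ 0 < derive1 f x * (rbar - x)}].

(* Since derive1 f is only defined a.e., "constant" means a.e. equal to a
   constant. *)
Definition flux_NLD {R : realType} (rmax : R) (f : R -> R) : Prop :=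
  forall a b : R, 0 <= a -> a < b -> b <= rmax ->
    ~ exists c : R, {ae lebesgue_measure, forall x : R, a <= x <= b ->
        derivable f x 1 /\ derive1 f x = c}.

(* For a continuous f the extrema over a compact interval are attained, so
   that inf and sup are the min and the max of the usual formula. *)
Definition godunov {R : realType} (f : R -> R) (a b : R) : R :=
  if a <= b then inf (f @` `[a, b]%classic) else sup (f @` `[b, a]%classic).

Definition seg {R : realType} (a b : R) : set R :=
  `[Num.min a b, Num.max a b]%classic.

Section Network.
Context {R : realType} {m n : nat}.
Variables (rmax : R) (f : 'I_(m + n) -> R -> R).

Definition flux_balance (u : 'I_(m + n) -> R) (p : R) : Prop :=
  \sum_(i < m) godunov (f (lshift n i)) (u (lshift n i)) p =
  \sum_(j < n) godunov (f (rshift m j)) p (u (rshift m j)).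

Definition GVV : set ('I_(m + n) -> R) :=
  [set u | (forall h, 0 <= u h <= rmax) /\
    exists p : R, [/\ 0 <= p <= rmax,
      flux_balance u p,
      forall i : 'I_m, godunov (f (lshift n i)) (u (lshift n i)) p =
                       f (lshift n i) (u (lshift n i)) &
      forall j : 'I_n, godunov (f (rshift m j)) p (u (rshift m j)) =
                       f (rshift m j) (u (rshift m j))]].

Definition GVVo : set ('I_(m + n) -> R) :=
  [set k | GVV k /\
    exists p : R, [/\ 0 <= p <= rmax,
      flux_balance k p,
      forall (i : 'I_m) (s : R), let h := lshift n i in
        (seg (k h) p `\ k h) s -> 0 < (p - k h) * (f h s - f h (k h)) &
      forall (j : 'I_n) (s : R), let h := rshift m j in
        (seg p (k h) `\ k h) s -> 0 < (k h - p) * (f h s - f h (k h))]].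

Definition Omega (h : 'I_(m + n)) : set R :=
  if (h < m)%N then `]-oo, 0[%classic else `]0, +oo[%classic.

Definition dt (phi : R * R -> R) (z : R * R) : R :=
  derive1 (fun t : R => phi (t, z.2)) z.1.
Definition dx (phi : R * R -> R) (z : R * R) : R :=
  derive1 (fun x : R => phi (z.1, x)) z.2.

(* Test functions for a second-order equation in z = (t, x): compactly
   supported in D, of class C^1 in t and C^2 in x. *)
Definition test_function (D : set (R * R)) (phi : R * R -> R) : Prop :=
  [/\ exists K : set (R * R),
        [/\ compact K, K `<=` D & forall z, ~ K z -> phi z = 0],
      continuous phi,
      (forall t x : R, derivable (fun s : R => phi (s, x)) t 1) /\
        continuous (dt phi),
      (forall t x : R, derivable (fun y : R => phi (t, y)) x 1) /\
        continuous (dx phi) &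
      (forall t x : R, derivable (fun y : R => dx phi (t, y)) x 1) /\
        continuous (dx (dx phi))].

(* rho_t + f(rho)_x = eps rho_xx in the sense of distributions on
   (0, +oo) x Omega_h; as f is merely Lipschitz, f(rho) need not be
   differentiable everywhere. *)
Definition viscous_equation (eps : R) (h : 'I_(m + n)) (rho : R -> R -> R) :
    Prop :=
  let D := `]0, +oo[%classic `*` Omega h in
  forall phi : R * R -> R, test_function D phi ->
    (\int[(lebesgue_measure \x lebesgue_measure)%E]_(z in D)
      (rho z.1 z.2 * dt phi z + f h (rho z.1 z.2) * dx phi z
       + eps * rho z.1 z.2 * dx (dx phi) z)%:E = 0)%E.

(* rho h t x is the density at time t > 0 and position x in the closure of
   Omega h. Both rho h and its x-derivative drho h are continuous on
   (0, +oo) x closure (Omega h), so that rho h t 0 and drho h t 0 are the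
   one-sided traces at the junction. *)
Definition viscous_solution (eps : R) (rho : 'I_(m + n) -> R -> R -> R) :
    Prop :=
  (forall h (t x : R), 0 < t -> closure (Omega h) x ->
    0 <= rho h t x <= rmax) /\
  exists drho : 'I_(m + n) -> R -> R -> R,
    [/\ forall h, let D := `]0, +oo[%classic `*` closure (Omega h) in
          {within D, continuous (fun z : R * R => rho h z.1 z.2)} /\
          {within D, continuous (fun z : R * R => drho h z.1 z.2)},
        forall h (t x : R), 0 < t -> Omega h x ->
          is_derive x 1 (rho h t) (drho h t x),
        forall h, viscous_equation eps h (rho h),
        forall (t : R) h h', 0 < t -> rho h t 0 = rho h' t 0 &
        forall t : R, 0 < t ->
          \sum_(i < m) (f (lshift n i) (rho (lshift n i) t 0)
                        - eps * drho (lshift n i) t 0) =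
          \sum_(j < n) (f (rshift m j) (rho (rshift m j) t 0)
                        - eps * drho (rshift m j) t 0)].

Definition stationary_solution (eps : R) (v : 'I_(m + n) -> R -> R) : Prop :=
  viscous_solution eps (fun h _ x => v h x).

Definition L1loc_cvg (v : R -> 'I_(m + n) -> R -> R)
    (w : 'I_(m + n) -> R -> R) : Prop :=
  forall (h : 'I_(m + n)) (A : set R),
    measurable A -> bounded_set A -> A `<=` Omega h ->
    (\int[lebesgue_measure]_(x in A) (`|v eps h x - w h x|)%:E)%E
      @[eps --> 0^'+] --> 0%E.

End Network.

(* Main.v *)
Require Import Defs.
From mathcomp Require Import measurable_realfun ring lra.

(** A steady state of the viscous equation on one road satisfies
    [eps * v' = f v - f k], where [f k] is the constant total flux
    [f v - eps * v'].  So it suffices to find, on each road, a solution of this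
    scalar autonomous equation that starts from the common density [p] at the
    junction and tends to [k] far away from it.  The strict inequalities in
    [GVVo] say exactly that [f - f k] vanishes only at [k] between [p] and [k], and
    has the sign that pushes the solution from [p] to [k] when one moves away
    from the junction; as [f] is Lipschitz, [k] is not reached in finite time
    and the solution exists on the whole road ([steady_layer]).  A rescaling in
    [x / eps] reduces every [eps] to [eps = 1].  At the junction the viscous
    flux of road [h] is the constant [f h (k h)], so that the conservation
    condition becomes [\sum_i f_i k_i = \sum_j f_j k_j]; this follows from the
    definition of [GVV] ([GVV_flux_balance]).

    The scalar equation is solved by separation of variables
    ([relaxation_profile]): the inverse of its solution is a primitive of an
    explicit continuous function that is bounded below by a positive constant.
    All functions are built on the whole line, on both sides of the junction,
    so that every continuity claim is global.

    The profiles are of class C^1, but [f] is only Lipschitz, so the equation is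
    meant in the sense of distributions.  Against a test function [phi], its
    integrand is the sum of the [t]-derivative of [v * phi] and of the
    [x]-derivative of [f k * phi + eps * v * dx phi]; both are continuous with
    compact support, and Fubini's theorem together with the fundamental theorem
    of calculus shows that they have integral zero ([steady_viscous_equation]).

    Finally [v (x / eps)] tends to [k] at each point of the open road while it
    stays in [0, rmax]; dominated convergence on a bounded set gives the L1
    limit ([rescaled_layer_L1_cvg]). *)

Set Implicit Arguments.
Unset Strict Implicit.
Unset Printing Implicit Defensive.

Local Open Scope ring_scope.
Local Open Scope classical_set_scope.

(** * Continuity *)

Lemma is_derive_continuous (R : realType) (F dF : R -> R) :
  (forall x : R, is_derive x 1 F (dF x)) -> continuous F.
Proof.
move=> dFE x; apply: differentiable_continuous; apply/derivable1_diffP.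
exact: ex_derive.
Qed.

Lemma continuous_pairl (R : realType) (x t : R) :
  {for t, continuous (fun s : R => (s, x))}.
Proof.
apply: (@cvg_pair _ _ _ _ (nbhs (t : R)) (nbhs (x : R))).
  exact: cvg_id.
exact: cvg_cst.
Qed.

Lemma continuous_pairr (R : realType) (x t : R) :
  {for x, continuous (fun y : R => (t, y))}.
Proof.
apply: (@cvg_pair _ _ _ _ (nbhs (t : R)) (nbhs (x : R))).
  exact: cvg_cst.
exact: cvg_id.
Qed.

Lemma continuous_comp_snd (R : realType) (g : R -> R) :
  continuous g -> continuous (fun z : R * R => g z.2).
Proof.
move=> cg z; apply: (@continuous_comp _ _ _ snd g); last exact: cg.
exact: (@cvg_snd _ _ (nbhs z.1) (nbhs z.2)).
Qed.

(** * The scalar equation of a steady layer *)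

(** Being constant on the left makes [phi - c] integrable on every [`]-oo, u]],
    so that one integral from [-oo] is a primitive on the whole line, with no
    case distinction on the sign of the upper bound. *)
Lemma exists_primitive_constant_left (R : realType) (phi : R -> R) (c : R) :
  continuous phi -> (forall y, y <= 0 -> phi y = c) ->
  exists S : R -> R, forall y : R, is_derive y 1 S (phi y).
Proof.
move=> cphi phic; pose psi y := phi y - c.
have cpsi : continuous psi by move=> x; apply: cvgB; [exact: cphi|exact: cvg_cst].
have mpsi : measurable_fun setT psi by exact: continuous_measurable_fun.
pose F x := (\int[lebesgue_measure]_(t in `]-oo, x]) psi t)%R.
have intpsi u : 0 <= u ->
    lebesgue_measure.-integrable `]-oo, u] (EFin \o psi).
  move=> u0.
  apply: (@eq_integrable _ (measurableTypeR R) _ _ _ _ ((EFin \o psi) \_ `[0, u])) => //.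
    move=> x; rewrite inE/= in_itv/= => xu; rewrite patchE; case: ifPn => //.
    rewrite notin_setE/= in_itv/= xu andbT => /negP; rewrite -ltNge => x0.
    by rewrite /psi phic ?subrr// ltW.
  apply/integrable_restrict => //.
  rewrite (_ : _ `&` _ = `[0, u]); last first.
    by apply/seteqP; split=> x /=; rewrite !in_itv/=; [move=> -[_ ->]|move=> /andP[-> ->]].
  apply: continuous_compact_integrable; first exact: segment_compact.
  exact: continuous_subspaceT.
exists (fun y => F y + c * y) => y.
have [u yu u0] : exists2 u, y < u & 0 <= u.
  by exists (`|y| + 1); [rewrite (le_lt_trans (ler_norm _)) ?ltrDl|rewrite addr_ge0].
have [dF F'] := @continuous_FTC1 R psi -oo%O y u yu (intpsi _ u0) (ltNyr _) (cpsi y).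
have dF' : is_derive y 1 F (psi y) by apply: DeriveDef => //; rewrite -F' derive1E.
apply: is_derive_eq.
by rewrite /psi /GRing.scale/=; ring.
Qed.

Lemma derivative_ge_growth (R : realType) (S phi : R -> R) (c : R) :
  (forall y, c <= phi y) -> (forall y : R, is_derive y 1 S (phi y)) ->
  forall x y, x <= y -> c * (y - x) <= S y - S x.
Proof.
move=> cphi dS x y; rewrite le_eqVlt => /predU1P[->|xy]; first by rewrite !subrr mulr0.
have cS : continuous S.
  exact: is_derive_continuous dS.
have [z _ ->] := @MVT _ S phi x y xy (fun z _ => dS z) (continuous_subspaceT cS).
by rewrite ler_pM2r ?subr_gt0.
Qed.

Lemma derivative_ge_bijective (R : realType) (S phi : R -> R) (c : R) :
  0 < c -> (forall y, c <= phi y) -> (forall y : R, is_derive y 1 S (phi y)) ->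
  exists2 Q : R -> R, cancel S Q & cancel Q S.
Proof.
move=> c0 cphi dS; have growth := derivative_ge_growth cphi dS.
have cS : continuous S.
  exact: is_derive_continuous dS.
have surj z : exists y, S y = z.
  pose M := `|z - S 0| / c + 1.
  have M0 : 0 < M by rewrite ltr_wpDl ?divr_ge0// ltW.
  have zM : `|z - S 0| <= c * M.
    by rewrite /M mulrDr mulr1 mulrCA divff ?gt_eqF// mulr1 lerDl ltW.
  have N0M : - M < 0 by rewrite oppr_lt0.
  have := growth _ _ (ltW M0); have := growth _ _ (ltW N0M).
  rewrite subr0 sub0r opprK => h1 h2.
  move: zM; rewrite ler_norml => /andP[h3 h4].
  have [||y _ <-] := @IVT _ S (- M) M z _ (continuous_subspaceT cS).
  - by lra.
  - by rewrite ge_min le_max; apply/andP; split; apply/orP; [left|right]; lra.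
  - by exists y.
have injS : injective S.
  have h x y : x < y -> S x <> S y.
    move=> xy Sxy; have := growth _ _ (ltW xy); rewrite Sxy subrr leNgt mulr_gt0// subr_gt0//.
  move=> x y Sxy; case: (ltgtP x y) => // xy; first by have := h _ _ xy.
  by have := h _ _ xy; rewrite Sxy.
exists (fun z => projT1 (cid (surj z))) => z.
  by apply: injS; case: cid.
by case: cid.
Qed.

(** The solution of [W' = - G W] with [W 0 = D] relaxes to the zero of [G].  It
    is sought as [W = D * exp (- Q)], which turns the equation into
    [Q' = G W / W]; hence the inverse [S] of [Q] has derivative
    [phi r = s / G s] at [s = D * exp (- r)].  The Lipschitz bound [G s <= C * s]
    gives [phi >= 1 / C], so that [S] is a bijection of the line and [W] needs an
    infinite time to reach [0]. *)
Lemma relaxation_profile (R : realType) (G : R -> R) (D C : R) : 0 < D ->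
  (forall s t, 0 <= s <= D -> 0 <= t <= D -> `|G s - G t| <= C * `|s - t|) ->
  G 0 = 0 -> (forall s, 0 < s <= D -> 0 < G s) ->
  exists W dW : R -> R,
    [/\ forall z : R, is_derive z 1 W (dW z), continuous dW, W 0 = D,
        forall z, 0 <= z -> 0 < W z <= D /\ dW z = - G (W z) &
        W z @[z --> +oo] --> 0].
Proof.
move=> D0 GC G0 Gpos.
have DD : 0 < D <= D by rewrite D0 lexx.
have OD : 0 <= (0 : R) <= D by rewrite lexx ltW.
have GCs s : 0 < s <= D -> G s <= C * s.
  move=> /andP[s0 sD]; have := GC s 0 _ OD; rewrite G0 !subr0 (ltW s0) sD => /(_ isT).
  by rewrite (gtr0_norm s0) => /(le_trans (ler_norm _)).
have C0 : 0 < C.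
  by have := GCs _ DD; have := Gpos _ DD => h1 h2; rewrite -(pmulr_lgt0 _ D0) (lt_le_trans h1).
(* The maximum freezes [s] at [D] for negative [r], where [G] is not
   controlled: this only changes the equation for negative times. *)
pose s (r : R) : R := D * expR (- Num.max r 0).
have s_itv r : 0 < s r <= D.
  rewrite /s mulr_gt0 ?expR_gt0//= ler_piMr ?(ltW D0)// -expR0 ler_expR.
  by rewrite oppr_le0 le_max lexx orbT.
have cs : continuous s.
  move=> r; apply: cvgM; first exact: cvg_cst.
  apply: (@continuous_cvg _ _ _ _ _ (fun r : R => - Num.max r 0) expR).
    exact: continuous_expR.
  by apply: cvgN; apply: continuous_max; [exact: cvg_id|exact: cvg_cst].
have cGs : continuous (G \o s).
  move=> r; apply/cvgrPdist_le => e e0.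
  have /cvgrPdist_le/(_ (e / C)) := cs r; rewrite divr_gt0// => /(_ isT).
  apply: filterS => t; rewrite ler_pdivlMr// mulrC => h.
  have w x : 0 <= s x <= D by case/andP: (s_itv x) => /ltW -> ->.
  exact: (le_trans (GC _ _ (w _) (w _))).
have Gs0 r : G (s r) != 0 by rewrite gt_eqF// Gpos.
pose phi (r : R) : R := s r / G (s r).
have cphi : continuous phi.
  by move=> r; apply: cvgM; [exact: cs|apply: cvgV; [exact: Gs0|exact: cGs]].
have phi0 r : r <= 0 -> phi r = D / G D.
  by move=> r0; rewrite /phi /s max_r// oppr0 expR0 mulr1.
have phiC r : C^-1 <= phi r.
  rewrite /phi ler_pdivlMr ?Gpos// mulrC ler_pdivrMr// mulrC; exact: GCs.
have Ci0 : 0 < C^-1 by rewrite invr_gt0.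
have phi_neq0 r : phi r != 0 by rewrite gt_eqF// (lt_le_trans Ci0).
have [S dS] := exists_primitive_constant_left cphi phi0.
have growth := derivative_ge_growth phiC dS.
have [Q SK QK] := derivative_ge_bijective Ci0 phiC dS.
have cS : continuous S by exact: is_derive_continuous dS.
have dQ (z : R) : is_derive z 1 Q (phi (Q z))^-1.
  rewrite -{1}(QK z); apply: is_derive_inverse => //.
    by near=> t; exact: SK.
  by near=> t; exact: cS.
have Qge M z : S M <= z -> M <= Q z.
  move=> Mz; rewrite leNgt; apply/negP => QM.
  have := growth _ _ (ltW QM); rewrite QK.
  have : 0 < C^-1 * (M - Q z) by rewrite mulr_gt0// subr_gt0.
  by lra.
(* [S] is only defined up to a constant: the shift by [S 0] makes [P 0 = 0]. *)
pose P (z : R) : R := Q (z + S 0).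
have dP (z : R) : is_derive z 1 P (phi (P z))^-1.
  have dshift : is_derive z 1 (fun z : R => z + S 0) 1.
    by apply: is_derive_eq; rewrite addr0.
  rewrite -[X in is_derive _ _ _ X]mulr1.
  exact: (is_derive1_comp (f := Q) (g := fun z => z + S 0) (dQ _) dshift).
have cP : continuous P by exact: is_derive_continuous dP.
exists (fun z => D * expR (- P z)), (fun z => D * (expR (- P z) * (- (phi (P z))^-1))).
split.
- move=> z; have dN : is_derive z 1 (fun z : R => - P z) (- (phi (P z))^-1).
    by apply: is_deriveN.
  exact: (is_deriveZ D (is_derive1_comp (is_derive_expR _) dN)).
- move=> z; apply: cvgM; first exact: cvg_cst.
  apply: cvgM; last first.
    apply: cvgN; apply: cvgV => //; apply: continuous_comp; first exact: cP.
    exact: cphi.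
  apply: (@continuous_cvg _ _ _ _ _ (fun z => - P z) expR).
    exact: continuous_expR.
  by apply: cvgN; exact: cP.
- by rewrite /P add0r SK oppr0 expR0 mulr1.
- move=> z z0; have Pz0 : 0 <= P z by apply: Qge; rewrite lerDr.
  have <- : s (P z) = D * expR (- P z) by rewrite /s max_l.
  split; first exact: s_itv.
  rewrite mulrA; have -> : D * expR (- P z) = s (P z) by rewrite /s max_l.
  rewrite /phi invf_div mulrN mulrC divfK// gt_eqF//.
  by case/andP: (s_itv (P z)).
- rewrite -[X in _ --> X](mulr0 D); apply: cvgM; first exact: cvg_cst.
  apply: (@cvg_comp _ _ _ P (fun x => expR (- x)) _ +oo); last exact: cvgr_expR.
  apply/cvgryPge => M; near=> z; apply: Qge.
  rewrite -lerBlDr; near: z; apply: nbhs_pinfty_ge; exact: num_real.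
Unshelve. all: by end_near.
Qed.

(** * Integrals of compactly supported derivatives in the plane *)

(** The plane has a countable basis of products of balls with rational centres
    and radii, and such products generate the product sigma-algebra. *)
Lemma open_measurable_prod (R : realType) (A : set (R * R)) :
  open A -> @measurable _ (measurableTypeR R * measurableTypeR R)%type A.
Proof.
move=> oA.
pose B (q r e : rat) : set (R * R) :=
  [set z | ball (ratr q : R) (ratr e) z.1 /\ ball (ratr r : R) (ratr e) z.2].
(* Guarding each box by its inclusion in [A] leaves three unconditional
   countable unions. *)
pose F (q r e : rat) := if `[< 0 < e /\ B q r e `<=` A >] then B q r e else set0.
have -> : A = \bigcup_q \bigcup_r \bigcup_e F q r e.
  apply/seteqP; split => [[x y] Axy|z [q _ [r _ [e _]]]]; last first.
    by rewrite /F; case: ifP => // /asboolP[_]; apply.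
  have /nbhs_ballP[d /= d0 dA] : nbhs (x, y) A by apply: oA.
  have d20 : 0 < d / 2 by rewrite divr_gt0.
  have [e] := @rat_in_itvoo R 0 (d / 2) d20.
  rewrite in_itv/= => /andP[e0 ed].
  have H (u : R) : exists q : rat, ball (ratr q : R) (ratr e) u.
    have ueu : u - ratr e < u + ratr e by lra.
    have [q] := @rat_in_itvoo R _ _ ueu.
    rewrite in_itv/= => /andP[h1 h2]; exists q.
    by rewrite /ball/= ltr_distlC; apply/andP; split; lra.
  have [q qx] := H x; have [r ry] := H y.
  exists q => //; exists r => //; exists e => //.
  rewrite /F asboolT//; split; first by rewrite -(ltr0q R).
  have BB (a b c : R) : ball a (ratr e) b -> ball a (ratr e) c -> ball b d c.
    move=> /ball_sym h1 h2; apply: le_ball (ball_triangle h1 h2); lra.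
  by move=> [x' y'] [/= h1 h2]; apply: dA; split; [exact: BB qx h1|exact: BB ry h2].
apply: bigcupT_measurable_rat => q; apply: bigcupT_measurable_rat => r.
apply: bigcupT_measurable_rat => e; rewrite /F; case: ifP => // _.
apply: (@measurableX _ _ (measurableTypeR R) (measurableTypeR R)
   (ball (ratr q : R) (ratr e)) (ball (ratr r : R) (ratr e))); exact: measurable_ball.
Qed.

Lemma continuous_measurable_fun_prod (R : realType) (H : R * R -> R) :
  continuous H ->
  @measurable_fun _ _ (measurableTypeR R * measurableTypeR R)%type R setT H.
Proof.
move=> /continuousP cH; apply: (measurability _ (RGenOpens.measurableE R)).
move=> _ [_ [a [b ->] <-]]; rewrite setTI; apply: open_measurable_prod.
exact/cH/interval_open.
Qed.

Lemma compact_prod_bounded (R : realType) (K : set (R * R)) : compact K ->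
  exists2 M : R, 0 < M & forall z, K z -> `|z.1| < M /\ `|z.2| < M.
Proof.
move=> /compact_bounded[M [_ hM]]; exists (`|M| + 2).
  by rewrite ltr_wpDl.
move=> z Kz; have := hM (`|M| + 1).
rewrite (le_lt_trans (ler_norm M)) ?ltrDl// => /(_ isT z Kz).
rewrite /= prod_normE ge_max => /andP[h1 h2].
by split; [rewrite (le_lt_trans h1)//|rewrite (le_lt_trans h2)//]; rewrite ltrD2l ltr1n.
Qed.

Section compactly_supported.
Context {R : realType}.
Variables (K : set (R * R)) (H : R * R -> R).
Hypotheses (cK : compact K) (cH : continuous H) (H0 : forall z, ~ K z -> H z = 0).
Local Notation mu := (@lebesgue_measure R).

Lemma integrable_compact_support :
  (mu \x mu)%E.-integrable setT (EFin \o H).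
Proof.
have [M M0 KM] := compact_prod_bounded cK.
pose B : set (measurableTypeR R * measurableTypeR R) := `[- M, M] `*` `[- M, M].
have mB : measurable B by apply: measurableX; exact: measurable_itv.
have KB : K `<=` B.
  by move=> z /KM[h1 h2]; split; rewrite /= in_itv/= -ler_norml ltW.
apply: (@eq_integrable _ (measurableTypeR R * measurableTypeR R)%type _ _ _ _ ((EFin \o H) \_ B)) => //.
  move=> z _; rewrite patchE; case: ifPn => //; rewrite notin_setE => nB.
  by rewrite /= H0// => /KB.
apply/integrable_restrict => //; rewrite setTI.
apply: measurable_bounded_integrable => //.
- have muB : ((mu \x mu)%E B = mu `[(- M)%R, M] * mu `[(- M)%R, M])%E.
    by apply: product_measure1E; exact: measurable_itv.
  suff: ((mu \x mu)%E B < +oo)%E by [].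
  by rewrite muB !lebesgue_measure_itv/=; case: ifP => _; rewrite ?mule0 ?ltry// -EFinM ltry.
- exact: measurable_funTS (continuous_measurable_fun_prod cH).
- have /compact_bounded[N [Nr hN]] : compact (H @` K).
    by apply: continuous_compact => //; exact: continuous_subspaceT.
  exists `|N|; split; first exact: num_real.
  move=> r Nr' z _ /=; have [Kz|nKz] := pselect (K z).
    by apply: hN; [exact: le_lt_trans (ler_norm _) Nr'|exists z].
  by rewrite H0// normr0 ltW// (le_lt_trans _ Nr').
Qed.


End compactly_supported.

Lemma integral_derivative_compact_support (R : realType) (h p : R -> R) (M : R) :
  0 < M -> continuous h -> (forall x : R, is_derive x 1 p (h x)) ->
  (forall x, M <= `|x| -> h x = 0 /\ p x = 0) ->
  (\int[lebesgue_measure]_x (h x)%:E = 0)%E.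
Proof.
move=> M0 ch dp hp0.
have cp : continuous p by exact: is_derive_continuous dp.
transitivity (\int[lebesgue_measure]_(x in `[(- M)%R, M]) (h x)%:E)%E.
  rewrite [RHS]integral_mkcond; apply: eq_integral => x _; rewrite patchE.
  case: ifPn => //; rewrite notin_setE/= in_itv/= -ler_norml => /negP; rewrite -ltNge => Mx.
  by rewrite (hp0 x (ltW Mx)).1.
rewrite (@continuous_FTC2 _ _ p).
- by rewrite (hp0 M _).2 ?(hp0 (- M) _).2 ?subee// ?normrN ?ler_norm.
- by rewrite (lt_trans _ M0)// oppr_lt0.
- exact: continuous_subspaceT.
- split; first by move=> x _; apply: ex_derive.
    by apply: cvg_at_right_filter; exact: cp.
  by apply: cvg_at_left_filter; exact: cp.
- by move=> x _; rewrite derive1E; have [_ ->] := dp x.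
Qed.

(** A partial derivative of a compactly supported function has integral zero: by
    Fubini's theorem one may first integrate in the variable of the
    derivative. *)
Section compactly_supported_derivatives.
Context {R : realType}.
Variables (K : set (R * R)) (H P : R * R -> R).
Hypotheses (cK : compact K) (cH : continuous H).
Hypotheses (H0 : forall z, ~ K z -> H z = 0) (P0 : forall z, ~ K z -> P z = 0).
Local Notation mu := (@lebesgue_measure R).

Lemma integral_dx_compact_support :
  (forall t x : R, is_derive x 1 (fun y => P (t, y)) (H (t, x))) ->
  (\int[(mu \x mu)%E]_z (H z)%:E = 0)%E.
Proof.
move=> dP; have [M M0 KM] := compact_prod_bounded cK.
rewrite -(integral12_prod_meas1 (integrable_compact_support cK cH H0)).
apply: integral0_eq => t _; rewrite /fubini_F/=.
apply: (@integral_derivative_compact_support _ _ (fun x => P (t, x)) M) => //.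
- move=> x; apply: (@continuous_comp _ _ _ (fun x => (t, x)) H); last exact: cH.
  exact: continuous_pairr.
- by move=> x Mx; split; [apply: H0|apply: P0] => /KM[_]; rewrite /= ltNge Mx.
Qed.

Lemma integral_dt_compact_support :
  (forall t x : R, is_derive t 1 (fun s => P (s, x)) (H (t, x))) ->
  (\int[(mu \x mu)%E]_z (H z)%:E = 0)%E.
Proof.
move=> dP; have [M M0 KM] := compact_prod_bounded cK.
rewrite -(integral21_prod_meas1 (integrable_compact_support cK cH H0)).
apply: integral0_eq => x _; rewrite /fubini_G/=.
apply: (@integral_derivative_compact_support _ _ (fun t => P (t, x)) M) => //.
- move=> t; apply: (@continuous_comp _ _ _ (fun t => (t, x)) H); last exact: cH.
  exact: continuous_pairl.
- by move=> t Mt; split; [apply: H0|apply: P0] => /KM[]; rewrite /= ltNge Mt.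
Qed.
End compactly_supported_derivatives.

(** * Steady profiles solve the viscous equation *)

Lemma derive1_near0 (R : realType) (g : R -> R) (x : R) :
  (\forall y \near x, g y = 0) -> derive1 g x = 0.
Proof.
move=> g0; have d0 : is_derive x 1 (cst 0 : R -> R) 0 by exact: is_derive_cst.
have [_ <-] : is_derive x 1 g 0; last by rewrite derive1E.
apply: near_eq_is_derive d0.
by near=> y; apply/esym; near: y.
Unshelve. all: by end_near.
Qed.

Lemma derivatives_off_support (R : realType) (K : set (R * R)) (phi : R * R -> R) :
  closed K -> (forall z, ~ K z -> phi z = 0) ->
  forall z, ~ K z -> dt phi z = 0 /\ dx phi z = 0.
Proof.
move=> cK phi0 [t x] nK.
have nbK : nbhs (t, x) (~` K) by have := closed_openC cK; rewrite openE; apply.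
split; apply: derive1_near0 => /=.
  have H : nbhs t ((fun s : R => (s, x)) @^-1` (~` K)) := @continuous_pairl R x t _ nbK.
  by apply: filterS H => s; exact: phi0.
have H : nbhs x ((fun y : R => (t, y)) @^-1` (~` K)) := @continuous_pairr R x t _ nbK.
by apply: filterS H => s; exact: phi0.
Qed.

(** The constant [c] is the total flux [f rho - eps * drho].  Replacing [f rho]
    by [c + eps * drho] in the weak formulation leaves an integrand that is
    continuous on the whole plane and is a sum of two exact derivatives. *)
Lemma steady_viscous_equation (R : realType) (m n : nat)
    (f : 'I_(m + n) -> R -> R) (eps c : R) (h : 'I_(m + n)) (rho drho : R -> R) :
  (forall x : R, is_derive x 1 rho (drho x)) -> continuous drho ->
  (forall x, Omega h x -> f h (rho x) = c + eps * drho x) ->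
  viscous_equation f eps h (fun _ x => rho x).
Proof.
move=> drhoE cdrho steady D phi [[K [cK KD phi0]] cphi [dtphi cdt] [dxphi cdx] [dxxphi cdxx]].
have clK : closed K by apply: compact_closed => //; exact: norm_hausdorff.
have d0 := derivatives_off_support clK phi0.
have dt0 z : ~ K z -> dt phi z = 0 by move=> /d0[].
have dx0 z : ~ K z -> dx phi z = 0 by move=> /d0[].
have dxx0 z : ~ K z -> dx (dx phi) z = 0.
  by move=> /(derivatives_off_support clK dx0)[].
have crho : continuous rho by exact: is_derive_continuous drhoE.
(* [H1] is the [t]-derivative of [rho * phi], and [H2] the [x]-derivative of
   [c * phi + eps * rho * dx phi]. *)
pose H1 (z : R * R) := rho z.2 * dt phi z.
pose H2 (z : R * R) := (c + eps * drho z.2) * dx phi z + eps * rho z.2 * dx (dx phi) z.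
have cH1 : continuous H1 by move=> z; apply: cvgM; [exact: (continuous_comp_snd crho)|exact: cdt].
have cH2 : continuous H2.
  move=> z; apply: cvgD; apply: cvgM; [|exact: cdx| |exact: cdxx].
    by apply: cvgD; [exact: cvg_cst|apply: cvgM; [exact: cvg_cst|exact: (continuous_comp_snd cdrho)]].
  by apply: cvgM; [exact: cvg_cst|exact: (continuous_comp_snd crho)].
have H10 z : ~ K z -> H1 z = 0 by move=> nK; rewrite /H1 dt0// mulr0.
have H20 z : ~ K z -> H2 z = 0 by move=> nK; rewrite /H2 dx0// dxx0// !mulr0 addr0.
have I1 : (\int[(lebesgue_measure \x lebesgue_measure)%E]_z (H1 z)%:E = 0)%E.
  apply: (integral_dt_compact_support (K := K) (P := fun z => rho z.2 * phi z)) => //.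
    by move=> z nK; rewrite phi0// mulr0.
  move=> t x; have dphi : is_derive t 1 (fun s : R => phi (s, x)) (dt phi (t, x)).
    by rewrite /dt derive1E; apply: derivableP.
  exact: (is_deriveZ (rho x) dphi).
have I2 : (\int[(lebesgue_measure \x lebesgue_measure)%E]_z (H2 z)%:E = 0)%E.
  apply: (integral_dx_compact_support (K := K)
    (P := fun z => c * phi z + eps * (rho z.2 * dx phi z))) => //.
    by move=> z nK; rewrite phi0// dx0// !mulr0 addr0.
  move=> t x; have dphi : is_derive x 1 (fun y : R => phi (t, y)) (dx phi (t, x)).
    by rewrite /dx derive1E; apply: derivableP.
  have ddphi : is_derive x 1 (fun y : R => dx phi (t, y)) (dx (dx phi) (t, x)).
    by rewrite {2}/dx derive1E; apply: derivableP.
  have := is_deriveD (is_deriveZ c dphi) (is_deriveZ eps (is_deriveM (drhoE x) ddphi)).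
  move/is_derive_eq; apply.
  by rewrite /H2 /GRing.scale/=; ring.
transitivity (\int[(lebesgue_measure \x lebesgue_measure)%E]_z ((H1 z)%:E + (H2 z)%:E))%E.
  rewrite integral_mkcond; apply: eq_integral => z _; rewrite patchE -EFinD.
  case: ifPn => [|]; last first.
    by rewrite notin_setE => nD; rewrite H10 ?H20 ?addr0// => /KD.
  rewrite inE => -[_ /= Oz]; congr (_%:E).
  by rewrite steady// /H1 /H2; ring.
rewrite integralD//=; first by rewrite I1 I2 adde0.
  exact: (integrable_compact_support cK cH1 H10).
exact: (integrable_compact_support cK cH2 H20).
Qed.

(** * The layer on one road and its vanishing viscosity limit *)

Lemma lipschitz_itv_bound (R : realType) (a b : R) (g : R -> R) :
  [lipschitz g x | x in `[a, b]] ->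
  exists C : R, forall s t, a <= s <= b -> a <= t <= b ->
    `|g s - g t| <= C * `|s - t|.
Proof.
case=> M [_ hM]; exists (M + 1) => s t hs ht.
by apply: (hM (M + 1) _ (s, t)); [rewrite ltrDl|split; rewrite /= in_itv].
Qed.

(** The sign [t] is [1] on an incoming road, where [x < 0], and [-1] on an
    outgoing one, so that [- t * x] is the distance to the junction.  With [s]
    the sign of [p - k], the unknown [w = s * (v - k)] decreases to [0] as a
    function of that distance and solves [w' = - G w] with
    [G w = s * t * (g (k + s * w) - g k)]; the sign hypothesis is the positivity
    of [G].  This reduces the four cases to [relaxation_profile]. *)
Lemma steady_layer (R : realType) (rmax k p t : R) (g : R -> R) :
  t ^+ 2 = 1 -> 0 <= k <= rmax -> 0 <= p <= rmax ->
  [lipschitz g x | x in `[0, rmax]] ->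
  (forall s, seg k p s -> s != k -> 0 < t * (p - k) * (g s - g k)) ->
  exists v dv : R -> R,
    [/\ forall x : R, is_derive x 1 v (dv x), continuous dv, v 0 = p,
        forall x, t * x <= 0 -> 0 <= v x <= rmax /\ dv x = g (v x) - g k &
        v (- t * z) @[z --> +oo] --> k].
Proof.
move=> t1 k0 p0 /lipschitz_itv_bound[C gC] gsgn.
have [->|pk] := eqVneq p k.
  exists (cst k), (cst 0); split => //.
  - by move=> x; exact: is_derive_cst.
  - by move=> x; exact: cvg_cst.
  - by move=> x _; rewrite subrr.
  - exact: cvg_cst.
have [s [s1 D0]] : exists s : R, s ^+ 2 = 1 /\ 0 < s * (p - k).
  have [pk'|pk'] := ltP k p; first by exists 1; rewrite expr1n mul1r subr_gt0.
  by exists (- 1); rewrite sqrrN expr1n mulN1r opprB subr_gt0 lt_neqAle pk.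
pose D := s * (p - k).
have pE : p = k + s * D by rewrite /D mulrA -expr2 s1 mul1r addrCA subrr addr0.
have s_pm : s = 1 \/ s = - 1.
  have : s ^+ 2 == 1 ^+ 2 by rewrite s1 expr1n.
  by rewrite eqf_sqr => /orP[]/eqP; [left|right].
have seg_itv w : 0 <= w <= D -> seg k p (k + s * w).
  rewrite /seg/= in_itv/= ge_min le_max => /andP[w0 wD]; rewrite pE.
  case: s_pm => ->; rewrite ?mul1r ?mulN1r; apply/andP; split; apply/orP; lra.
have seg_bd w : 0 <= w <= D -> 0 <= k + s * w <= rmax.
  move=> /seg_itv; rewrite /seg/= in_itv/= => /andP[h1 h2].
  case/andP: k0 => k0 k1; case/andP: p0 => p0 p1.
  by rewrite (le_trans _ h1) ?le_min ?k0// (le_trans h2)// ge_max k1.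
pose G w := s * t * (g (k + s * w) - g k).
have normst : `|s * t| = 1.
  by apply/eqP; rewrite -(@eqrXn2 _ 2)// -normrX exprMn s1 t1 mulr1 normr1 expr1n.
have norms : `|s| = 1.
  by apply/eqP; rewrite -(@eqrXn2 _ 2)// -normrX s1 normr1 expr1n.
have [W [dW [dWE cdW W0 Wbd Wlim]]] : exists W dW : R -> R,
    [/\ forall z : R, is_derive z 1 W (dW z), continuous dW, W 0 = D,
        forall z, 0 <= z -> 0 < W z <= D /\ dW z = - G (W z) &
        W z @[z --> +oo] --> 0].
  apply: (@relaxation_profile _ G D C D0).
  - move=> x y xD yD; rewrite /G -mulrBr normrM normst mul1r.
    have -> : g (k + s * x) - g k - (g (k + s * y) - g k) = g (k + s * x) - g (k + s * y) by ring.
    apply: (le_trans (gC _ _ (seg_bd _ xD) (seg_bd _ yD))).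
    have -> : k + s * x - (k + s * y) = s * (x - y) by ring.
    by rewrite normrM norms mul1r.
  - by rewrite /G mulr0 addr0 subrr mulr0.
  - move=> w /andP[w0 wD]; have wD' : 0 <= w <= D by rewrite ltW.
    have := gsgn _ (seg_itv _ wD').
    have wk : k + s * w != k.
      rewrite -subr_eq0 addrAC subrr add0r; apply: mulf_neq0; last by rewrite gt_eqF.
      by rewrite -normr_eq0 norms oner_eq0.
    move=> /(_ wk).
    have -> : t * (p - k) * (g (k + s * w) - g k) = D * G w.
      have -> : D * G w = s ^+ 2 * (t * (p - k) * (g (k + s * w) - g k)) by rewrite /D /G; ring.
      by rewrite s1 mul1r.
    by rewrite pmulr_rgt0.
exists (fun x => k + s * W (- t * x)), (fun x => s * (dW (- t * x) * - t)).
have cl (x : R) : {for x, continuous (fun x => - t * x)}.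
  by apply: cvgM; [exact: cvg_cst|exact: cvg_id].
split.
- move=> x; have dl : is_derive x 1 (fun x : R => - t * x) (- t).
    by apply: is_derive_eq; rewrite /GRing.scale/=; ring.
  have dWl := is_derive1_comp (dWE (- t * x)) dl.
  have := is_deriveD (is_derive_cst k x 1) (is_deriveZ s dWl).
  by move/is_derive_eq; apply; rewrite add0r.
- move=> x; apply: cvgM; first exact: cvg_cst.
  apply: cvgM; last exact: cvg_cst.
  by apply: (@continuous_comp _ _ _ (fun x => - t * x) dW); [exact: cl|exact: cdW].
- by rewrite mulr0 W0.
- move=> x tx; have z0 : 0 <= - t * x by rewrite mulNr oppr_ge0.
  have [/andP[h1 h2] h3] := Wbd _ z0.
  split; first by apply: seg_bd; rewrite ltW.
  rewrite h3 /G.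
  have -> : s * (- (s * t * (g (k + s * W (- t * x)) - g k)) * - t) =
    s ^+ 2 * t ^+ 2 * (g (k + s * W (- t * x)) - g k) by ring.
  by rewrite s1 t1 !mul1r.
- rewrite -[X in _ --> X]addr0; apply: cvgD; first exact: cvg_cst.
  rewrite -[X in _ --> X](mulr0 s); apply: cvgM; first exact: cvg_cst.
  rewrite (_ : (fun z => W (- t * (- t * z))) = W)//; apply/funext => z.
  by rewrite mulrA mulrNN -expr2 t1 mul1r.
Qed.

Lemma bounded_lebesgue_measure_fin (R : realType) (A : set R) :
  @measurable _ (measurableTypeR R) A -> bounded_set A -> (lebesgue_measure A < +oo)%E.
Proof.
move=> mA [M [_ hM]]; apply: (@le_lt_trans _ _ (lebesgue_measure (`[- (M + 1), M + 1]%classic : set R))).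
  apply: le_measure; [by rewrite inE|by rewrite inE; exact: measurable_itv|].
  move=> x Ax; rewrite /= in_itv/= -ler_norml; apply: (hM (M + 1)) => //.
  by rewrite ltrDl.
by rewrite lebesgue_measure_itv/=; case: ifP => _; rewrite ?ltry// -EFinD ltry.
Qed.

(** At a point with [t * x < 0] the argument [x / e] goes to infinity away from
    the junction as [e] decreases to [0], so the integrand tends to [0]
    pointwise; the constant [C] dominates it, and [A] has finite measure. *)
Lemma rescaled_layer_L1_cvg (R : realType) (v : R -> R) (k t C : R) (A : set R) :
  t ^+ 2 = 1 -> continuous v -> (forall x, t * x <= 0 -> `|v x - k| <= C) ->
  v (- t * z) @[z --> +oo] --> k ->
  @measurable _ (measurableTypeR R) A -> bounded_set A -> (forall x, A x -> t * x < 0) ->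
  ((\int[lebesgue_measure]_(x in A) (`|v (x / e) - k|)%:E)%E @[e --> 0^'+] --> 0%E).
Proof.
move=> t1 cv vC vlim mA bA At.
have muA := bounded_lebesgue_measure_fin mA bA.
have cve (e : R) : continuous (fun x : R => `|v (x / e) - k|).
  move=> x; apply: cvg_norm; apply: cvgB; last exact: cvg_cst.
  apply: (@continuous_comp _ _ _ (fun x : R => x / e) v); last exact: cv.
  by apply: cvgM; [exact: cvg_id|exact: cvg_cst].
have mve (e : R) : @measurable_fun _ _ (measurableTypeR R) _ A (EFin \o (fun x : R => `|v (x / e) - k|)).
  apply/measurable_EFinP; apply: measurable_funTS.
  exact: continuous_measurable_fun (cve e).
have vCe (e x : R) : 0 < e -> A x -> `|v (x / e) - k| <= C.
  by move=> e0 Ax; apply: vC; rewrite mulrA pmulr_lle0 ?invr_gt0// ltW// At.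
have iC : (@lebesgue_measure R).-integrable A (EFin \o cst C).
  apply: (@measurable_bounded_integrable _ (measurableTypeR R)) => //.
  by exists `|C|; split; [exact: num_real|move=> r /ltW Cr x _].
have ive (e : R) : 0 < e -> (@lebesgue_measure R).-integrable A (EFin \o (fun x : R => `|v (x / e) - k|)).
  move=> e0; apply: le_integrable iC => // x Ax /=.
  by rewrite lee_fin normr_id (le_trans (vCe _ _ e0 Ax))// ler_norm.
apply/fine_cvgP; split.
  near=> e; have e0 : 0 < e by near: e; exact: nbhs_right_gt.
  exact: integrable_fin_num (ive _ e0).
apply/cvg_at_rightP => u [u0 ulim].
have : (\int[lebesgue_measure]_(x in A) (`|v (x / u n) - k|)%:E)%E @[n --> \oo] -->
    (\int[lebesgue_measure]_(x in A) (cst 0%E x))%E.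
  apply: (@dominated_cvg _ (measurableTypeR R) _ _ _ mA _ _ (EFin \o cst C)) => //.
  - by move=> n; exact: mve.
  - move=> x Ax; apply: cvg_EFin; first exact: nearW.
    rewrite -(normr0 R) -(subrr k); apply: cvg_norm; apply: cvgB; last exact: cvg_cst.
    have -> : (fun n => v (x / u n)) = (fun n => v (- t * (- t * x / u n))).
      by apply/funext => n; congr v; rewrite !mulrA mulrNN -expr2 t1 mul1r.
    apply: (@cvg_comp _ _ _ (fun n => - t * x / u n) (fun z => v (- t * z)) _ +oo _ _ vlim).
    have tx : 0 < - t * x by rewrite mulNr oppr_gt0 At.
    apply/cvgryPge => M; near=> n.
    have Mu : u n < - t * x / (`|M| + 1).
      near: n; move/cvgrPdist_lt: ulim => /(_ (- t * x / (`|M| + 1))).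
      rewrite divr_gt0// ?ltr_wpDl// => /(_ isT); apply: filterS => n.
      by rewrite sub0r normrN gtr0_norm.
    rewrite ler_pdivlMr//; move: Mu; rewrite ltr_pdivlMr ?ltr_wpDl// mulrC => /ltW.
    apply: le_trans; rewrite ler_pM2r// (le_trans (ler_norm _))// lerDl//.
  - by move=> n x Ax /=; rewrite lee_fin normr_id vCe.
rewrite integral_cst// mul0e => /fine_cvgP[_]; exact.
Unshelve. all: by end_near.
Qed.

(** * The network *)

(** With this sign the two kinds of roads are treated together: the road is the
    set of [x] such that [side h * x < 0]. *)
Definition side {R : realType} {m n : nat} (h : 'I_(m + n)) : R :=
  if (h < m)%N then 1 else - 1.

Lemma side_sqr (R : realType) (m n : nat) (h : 'I_(m + n)) : side h ^+ 2 = 1 :> R.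
Proof. by rewrite /side; case: ifP => _; rewrite ?sqrrN expr1n. Qed.

Lemma OmegaE (R : realType) (m n : nat) (h : 'I_(m + n)) :
  Omega h = [set x : R | side h * x < 0].
Proof.
rewrite /Omega /side; case: ifP => _; apply/seteqP; split=> x /=;
  by rewrite in_itv/= ?andbT ?mul1r// mulN1r oppr_lt0.
Qed.

Lemma closure_Omega (R : realType) (m n : nat) (h : 'I_(m + n)) (x : R) :
  closure (Omega h) x -> side h * x <= 0.
Proof.
have cl : closed [set x : R | side h * x <= 0].
  have -> : [set x : R | side h * x <= 0] = (fun x => side h * x) @^-1` [set y | y <= 0] by [].
  apply: closed_comp; last exact: closed_le.
  by move=> y _; apply: cvgM; [exact: cvg_cst|exact: cvg_id].
have sub : Omega h `<=` [set x : R | side h * x <= 0].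
  by rewrite OmegaE => y /ltW.
by move/(closureS sub); rewrite -(closure_id _).1.
Qed.

Lemma seg_sym (R : realType) (a b : R) : seg a b = seg b a.
Proof. by rewrite /seg minC maxC. Qed.

(** [GVVo] writes the intervals and the differences in opposite orders on
    incoming and outgoing roads; the factor [side h] absorbs this. *)
Lemma GVVo_layer_sign (R : realType) (m n : nat) (rmax : R) (f : 'I_(m + n) -> R -> R)
    (k : 'I_(m + n) -> R) : GVVo rmax f k ->
  exists2 p : R, 0 <= p <= rmax &
    forall h s, seg (k h) p s -> s != k h ->
      0 < side h * (p - k h) * (f h s - f h (k h)).
Proof.
case=> _ [p [p0 _ hi hj]]; exists p => // h s; case: (split_ordP h) => [i ->|j ->].
  move=> ss sk; rewrite /side /= ltn_ord mul1r; apply: hi; split=> //; exact/eqP.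
move=> ss sk; rewrite /side /= ltnNge leq_addr /= mulN1r opprB; apply: hj.
by rewrite seg_sym; split=> //; exact/eqP.
Qed.

Lemma GVV_flux_balance (R : realType) (m n : nat) (rmax : R) (f : 'I_(m + n) -> R -> R)
    (k : 'I_(m + n) -> R) : GVV rmax f k ->
  \sum_(i < m) f (lshift n i) (k (lshift n i)) =
  \sum_(j < n) f (rshift m j) (k (rshift m j)).
Proof.
case=> _ [p [_ bal fi fj]]; move: bal; rewrite /flux_balance.
by rewrite (eq_bigr _ (fun i _ => fi i)) (eq_bigr _ (fun j _ => fj j)).
Qed.

(** The layers are glued by their common value [p] at the junction; there the
    viscous flux of road [h] equals its value [f h (k h)] at infinity. *)
Lemma layers_stationary (R : realType) (m n : nat) (rmax p eps : R)
    (f : 'I_(m + n) -> R -> R) (k : 'I_(m + n) -> R)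
    (v dv : 'I_(m + n) -> R -> R) : 0 < eps ->
  \sum_(i < m) f (lshift n i) (k (lshift n i)) =
    \sum_(j < n) f (rshift m j) (k (rshift m j)) ->
  (forall h (x : R), is_derive x 1 (v h) (dv h x)) ->
  (forall h, continuous (dv h)) -> (forall h, v h 0 = p) ->
  (forall h x, side h * x <= 0 ->
    0 <= v h x <= rmax /\ dv h x = f h (v h x) - f h (k h)) ->
  stationary_solution rmax f eps (fun h x => v h (x / eps)).
Proof.
move=> eps0 bal dvE cdv v0 vode.
have scale (h : 'I_(m + n)) (x : R) : side h * x <= 0 -> side h * (x / eps) <= 0.
  by move=> hx; rewrite mulrA pmulr_lle0 ?invr_gt0.
have dvs h (x : R) : is_derive x 1 (fun x => v h (x / eps)) (dv h (x / eps) / eps).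
  have dl : is_derive x 1 (fun x : R => x / eps) eps^-1.
    by apply: is_derive_eq; rewrite /GRing.scale/=; ring.
  exact: (is_derive1_comp (dvE h _) dl).
have cl : continuous (fun x : R => x / eps).
  by move=> x; apply: cvgM; [exact: cvg_id|exact: cvg_cst].
have cdvs h : continuous (fun x : R => dv h (x / eps) / eps).
  move=> x; apply: cvgM; last exact: cvg_cst.
  by apply: (@continuous_comp _ _ _ (fun x : R => x / eps) (dv h)); [exact: cl|exact: cdv].
have cvs h : continuous (fun x : R => v h (x / eps)).
  exact: is_derive_continuous (dvs h).
split.
  by move=> h _ x _ /closure_Omega/scale/vode[].
exists (fun h _ x => dv h (x / eps) / eps); split.
- move=> h D; split; apply: continuous_subspaceT.
    exact: (continuous_comp_snd (cvs h)).
  exact: (continuous_comp_snd (cdvs h)).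
- by move=> h _ x _ _; exact: dvs.
- move=> h; apply: (steady_viscous_equation (c := f h (k h)) (dvs h) (cdvs h)) => x.
  rewrite OmegaE => /ltW/scale/vode[_ ->].
  by rewrite [eps * _]mulrC divfK ?gt_eqF// addrC subrK.
- by move=> _ h h' _; rewrite mul0r !v0.
- have flux h : f h (v h (0 / eps)) - eps * (dv h (0 / eps) / eps) = f h (k h).
    have /vode[_] : side h * (0 : R) <= 0 by rewrite mulr0.
    rewrite mul0r => ->.
    by rewrite [eps * _]mulrC divfK ?gt_eqF// opprB addrC subrK.
  move=> _ _; rewrite (eq_bigr _ (fun i _ => flux (lshift n i))).
  by rewrite (eq_bigr _ (fun j _ => flux (rshift m j))).
Qed.

Unset Implicit Arguments.
Set Strict Implicit.

Theorem corollary1 (R : realType) (m n : nat) (rmax : R)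
    (L : 'I_(m + n) -> R) (f : 'I_(m + n) -> R -> R)
    (hm : (1 <= m)%N) (hn : (1 <= n)%N) (hrmax : 0 < rmax)
    (hF : forall h, flux_F rmax (L h) (f h))
    (hNLD : forall h, flux_NLD rmax (f h))
    (k : 'I_(m + n) -> R) (hk : GVVo rmax f k) :
  exists keps : R -> 'I_(m + n) -> R -> R,
    (forall eps : R, 0 < eps -> stationary_solution rmax f eps (keps eps)) /\
    L1loc_cvg keps (fun h _ => k h).
Proof.
have [GVVk _] := hk; have [p p0 psgn] := GVVo_layer_sign hk.
have k0 : forall h, 0 <= k h <= rmax by case: GVVk.
have layer h : exists w : (R -> R) * (R -> R),
    [/\ forall x : R, is_derive x 1 w.1 (w.2 x), continuous w.2, w.1 0 = p,
        forall x, side h * x <= 0 ->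
          0 <= w.1 x <= rmax /\ w.2 x = f h (w.1 x) - f h (k h) &
        w.1 (- side h * z) @[z --> +oo] --> k h].
  have [_ lip _ _ _] := hF h.
  have [v [dv H]] := steady_layer (side_sqr R h) (k0 h) p0 lip (psgn h).
  by exists (v, dv).
have [w /all_and5[wd cdw w0 wode wlim]] := choice layer.
exists (fun eps h x => (w h).1 (x / eps)); split.
  move=> eps eps0.
  exact: (@layers_stationary _ _ _ rmax p eps f k (fun h => (w h).1) (fun h => (w h).2)
    eps0 (GVV_flux_balance GVVk) wd cdw w0 wode).
move=> h A mA bA AO; apply: (@rescaled_layer_L1_cvg _ _ _ (side h) rmax) => //.
- exact: side_sqr.
- exact: is_derive_continuous (wd h).
- move=> x /wode[/andP[h1 h2] _]; case/andP: (k0 h) => h3 h4.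
  by rewrite ler_norml; apply/andP; split; lra.
- by move=> x /AO; rewrite OmegaE.
Qed.
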